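(* The cumulative layer distribution $\bar\ell_k$ of the infinite random recursive tree satisfies $$e^{-k}\lesssim \bar\ell_k\lesssim e^{-k/e},$$ that is, there exist constants $C_1,C_2>0$ such that $e^{-k}\le C_1\,\bar\ell_k$ and $\bar\ell_k\le C_2\,e^{-k/e}$ for all $k$.
   Context: A random recursive tree (RRT) $G_n$ of size $n$ is a random labeled tree on the node set $\{1,\dots,n\}$ built as follows: start with node $1$; for $t=2,\dots,n$, node $t$ is attached by an edge to one node chosen uniformly at random from the existing nodes $\{1,\dots,t-1\}$, independently of previous choices. A leaf is a node of degree $1$ (the root, node $1$, is also a leaf if it has degree $1$). The layer of a node is the number of times all current leaves must be simultaneously stripped off (removed) from the tree for the node to become a leaf; leaves of the original tree are at layer $0$. If after some number of rounds the remaining tree consists of a single isolated node, that node counts as a leaf at that stage. Let $L_{n,k}$ be the number of nodes at layer $k\in\{0,1,2,\dots\}$ in $G_n$, let $\ell_k(n)=\mathbb E[L_{n,k}/n]$, and let $\ell_k=\lim_{n\to\infty}\ell_k(n)$ (these limits exist). The cumulative layer distribution of the infinite RRT is $\bar\ell_k=\sum_{k'=k}^\infty \ell_{k'}$. *)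

(* Defs.v *)
(* MathComp-Analysis *)
From HB Require Import structures.
From mathcomp Require Import all_boot all_order all_algebra.
From mathcomp Require Import all_classical all_reals all_analysis.

Set Implicit Arguments.
Unset Strict Implicit.
Unset Printing Implicit Defensive.

Import Order.TTheory GRing.Theory Num.Theory.
Import numFieldNormedType.Exports.

Local Open Scope ring_scope.

Section Stripping.
Variables (T : finType) (e : rel T).

Definition degree_in (A : {set T}) (x : T) : nat := #|[set y in A | e x y]|.

(* The second disjunct makes the last remaining node of a tree a leaf. *)
Definition is_leaf (A : {set T}) (x : T) : bool :=
  (x \in A) && ((degree_in A x == 1)%N || (A == [set x])).

Definition leaves (A : {set T}) : {set T} := [set x | is_leaf A x].

Definition strip (A : {set T}) : {set T} := A :\: leaves A.

(* A leaf is removed by the next round, so a node is a leaf after at most one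
   number [k] of rounds: this [k] is its layer. *)
Definition at_layer (k : nat) (x : T) : bool := is_leaf (iter k strip [set: T]) x.

End Stripping.

(* Nodes are numbered from 0: the node [t : 'I_n] stands for the label [t + 1].
   A node [t > 0] chooses among the [t] nodes 0, ..., t - 1, since then
   [t.-1.+1 = t]; the root 0 only has the dummy choice in ['I_1]. *)
Definition choices (n : nat) := {dffun forall t : 'I_n, 'I_(t.-1.+1)}.

Definition attached n (c : choices n) (t s : 'I_n) : bool :=
  (0 < t)%N && (c t == s :> nat).

Definition rrt_edge n (c : choices n) : rel 'I_n :=
  [rel x y | attached c x y || attached c y x].

Definition layer_count n (k : nat) (c : choices n) : nat :=
  #|[set x | at_layer (rrt_edge c) k x]|.

Section RandomRecursiveTree.
Variable R : realType.

(* The choices are independent, and that of [t > 0] is uniform on [t] nodes. *)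
Definition rrt_prob n (c : choices n) : R := \prod_(t < n | (0 < t)%N) t%:R^-1.

Definition rrt_expect n (X : choices n -> R) : R :=
  \sum_(c : choices n) rrt_prob c * X c.

Definition layer_frac (k n : nat) : R :=
  rrt_expect (fun c : choices n => (layer_count k c)%:R / n%:R).

Definition layer_lim (k : nat) : R := limn (layer_frac k).

(* Extended-real valued: a divergent tail would have the value [+oo]. *)
Definition cum_layer (k : nat) : \bar R :=
  (\sum_(k <= k' <oo) (layer_lim k')%:E)%E.

End RandomRecursiveTree.

(* Main.v *)
Require Import Defs.
From mathcomp Require Import all_boot all_order all_algebra.
From mathcomp Require Import all_classical all_reals all_analysis.
From mathcomp Require Import zify ring lra.

Set Implicit Arguments.
Unset Strict Implicit.
Unset Printing Implicit Defensive.

Import Order.TTheory GRing.Theory Num.Theory.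
Import numFieldNormedType.Exports.

(** Why the theorem holds. A node x is stripped as soon as at most one of the
branches at x is left, and the branch hanging off x through a neighbour y
survives as many rounds as it has levels. For most nodes the branch through the
parent is the tallest one, so the layer of x is the height of its fringe
subtree, the subtree formed by x and its descendants. Two inductions on the
number of rounds make this precise: a node surviving k rounds has a descendant
k levels below it ([strip_tall]), and a node of depth at least k with such a
descendant survives k rounds ([tall_strip]). The expected number of nodes of
depth at most k is o(n), so the cumulative layer distribution at k is the
limiting proportion of fringe subtrees of height at least k.

The fringe subtree of a random node is itself a random recursive tree, of
random size: size m has limiting probability 1 / (m (m + 1)). An exact version
for the nodes other than the root holds at every n ([fringe_expect]); it comes
from conditioning on the last attachment, which either misses the fringe
subtree or adds a uniform node to it. Hence, with H_m the height of a random
recursive tree with m nodes,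
  [cum_layer] k = sum over m of P(H_m >= k) / (m (m + 1)).

Upper bound: the sum of z ^ depth over the nodes has mean the product of
1 + z / i for 0 < i < m, which is at most exp(z (1 + ln m)). Taking z = e,
Markov's inequality gives P(H_m >= k) <= exp(e + e ln m - k). This is used for
m <= exp(k / e), and P(H_m >= k) <= 1 beyond, where the weights 1 / (m (m + 1))
add up to at most exp(- k / e); both parts are O(exp(- k / e)).

Lower bound: P(H_m >= k) is at least N_m(k) / m, where N_m(k) is the expected
number of nodes of depth at least k. The recursion
N_(m+1)(k+1) = N_m(k+1) + N_m(k) / m and a summation by parts show that the sum
of N_m(k) / (m (m + 1) (m + 2)) is exactly halved when k increases by one. The
cumulative layer distribution is therefore at least a constant times 2 ^ -k,
which is more than e ^ -k. *)

(** * Recursive trees as attachment histories *)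

(** A recursive tree on the nodes 0, ..., n is the list of the n nodes chosen
by n, ..., 1, the latest choice first: adding a node is then a [cons]. *)
Fixpoint valid (s : seq nat) : bool :=
  if s is i :: s' then (i <= size s') && valid s' else true.

Fixpoint parent (s : seq nat) (y : nat) : nat :=
  if s is i :: s' then (if y == (size s').+1 then i else parent s' y) else 0.

Fixpoint depth (s : seq nat) (y : nat) : nat :=
  if s is i :: s' then
    (if y == (size s').+1 then (depth s' i).+1 else depth s' y)
  else 0.

(** The latest arrival comes first. A node [x] is among its own descendants, and
has none before it arrives. *)
Fixpoint desc (x : nat) (s : seq nat) : seq nat :=
  if s is i :: s' then
    let v := (size s').+1 in
    if (v == x) || (i \in desc x s') then v :: desc x s' else desc x s'
  else if x == 0 then [:: 0] else [::].

(** The depths inside the fringe subtree of [x], one entry for each node. This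
list is all that is remembered of a fringe subtree: it determines the height,
and it evolves as a Markov chain when the tree grows. *)
Definition profile (x : nat) (s : seq nat) : seq nat :=
  [seq depth s y - depth s x | y <- desc x s].

Lemma parent_lt s y : valid s -> 0 < y <= size s -> parent s y < y.
Proof.
elim: s => [|i s IHs] /=; first by lia.
move=> /andP[ile vs] yle; case: eqP => [->|yn]; first by lia.
by apply: IHs => //; lia.
Qed.

Lemma depth_parent s y :
  valid s -> 0 < y <= size s -> depth s y = (depth s (parent s y)).+1.
Proof.
elim: s => [|i s IHs] /=; first by lia.
move=> /andP[ile vs] yle; have [_|yn] := eqVneq y (size s).+1.
  by rewrite ifN //; lia.
have yle' : 0 < y <= size s by lia.
by rewrite ifN; [exact: IHs | have := parent_lt vs yle'; lia].
Qed.

Lemma desc_range s x y : y \in desc x s -> x <= y <= size s.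
Proof.
elim: s y => [|i s IHs] y /=.
  by case: eqP => // ->; rewrite inE => /eqP ->.
have out z : z \in desc x s -> x <= z <= (size s).+1 by move/IHs; lia.
case: orP => [h|_]; last exact: out.
rewrite inE => /orP[/eqP ->|]; last exact: out.
by case: h => [/eqP <-|/IHs]; lia.
Qed.

Lemma desc_new s x : (size s).+1 \in desc x s = false.
Proof. by apply/negP => /desc_range; lia. Qed.

Lemma desc_uniq s x : uniq (desc x s).
Proof.
elim: s => [|i s IHs] /=; first by case: ifP.
by case: ifP => //= _; rewrite desc_new.
Qed.

Lemma mem_desc s x y : valid s -> y <= size s ->
  (y \in desc x s) = (y == x) || ((0 < y) && (parent s y \in desc x s)).
Proof.
elim: s => [|i s IHs] /=.
  move=> _; rewrite leqn0 => /eqP ->; rewrite eq_sym /=.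
  by case: eqP => // ->.
move=> /andP[ile vs] yle.
have old z : z <= size s ->
  (z \in if ((size s).+1 == x) || (i \in desc x s)
         then (size s).+1 :: desc x s else desc x s) = (z \in desc x s).
  by move=> zle; case: ifP => // _; rewrite inE eqn_leq [_ < z]ltnNge zle andbF.
have [->|yn] := eqVneq y (size s).+1.
  rewrite (old i ile); case: ifP; first by rewrite mem_head.
  by rewrite desc_new.
have yle' : y <= size s by lia.
rewrite old // IHs //; case: (posnP y) => [->|y0] //=.
by rewrite old //; have := @parent_lt s y vs; lia.
Qed.

Lemma desc_self s x : valid s -> x <= size s -> x \in desc x s.
Proof. by move=> vs xs; rewrite mem_desc // eqxx. Qed.

Lemma desc_trans s x y z : valid s ->
  y \in desc x s -> z \in desc y s -> z \in desc x s.
Proof.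
move=> vs yx; have [m] := ubnP z; elim: m z => // m IHm z zm zy.
have /andP[_ zs] := desc_range zy.
move: zy; rewrite mem_desc // => /predU1P[-> //|/andP[z0 pz]].
rewrite mem_desc // z0 IHm ?orbT //.
by have : parent s z < z; [apply: parent_lt => //; lia | lia].
Qed.

Lemma desc_child s x z : valid s -> z \in desc x s -> z != x ->
  exists2 y, (0 < y <= size s) && (parent s y == x) & z \in desc y s.
Proof.
move=> vs; have [m] := ubnP z; elim: m z => // m IHm z zm zx zNx.
have /andP[_ zs] := desc_range zx.
move: zx; rewrite mem_desc // (negPf zNx) /= => /andP[z0 pz].
case: (eqVneq (parent s z) x) => [pzx|pzN].
  by exists z; [rewrite z0 zs pzx eqxx | exact: desc_self].
have pzz : parent s z < z by apply: parent_lt => //; lia.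
have [y hy py] := IHm (parent s z) (leq_trans pzz zm) pz pzN.
by exists y => //; rewrite mem_desc // z0 py orbT.
Qed.

(** The height of a tree is the largest entry of its profile. *)
Definition tall k (l : seq nat) : bool := has (leq k) l.

Lemma depth_desc s x y : valid s -> y \in desc x s -> depth s x <= depth s y.
Proof.
move=> vs; have [m] := ubnP y; elim: m y => // m IHm y ym yx.
have /andP[_ ys] := desc_range yx.
move: yx; rewrite mem_desc // => /predU1P[-> //|/andP[y0 py]].
have y0s : 0 < y <= size s by lia.
by rewrite (@depth_parent s y) // leqW // IHm //; have := parent_lt vs y0s; lia.
Qed.

Lemma tall0 s x : valid s -> x <= size s -> tall 0 (profile x s).
Proof.
move=> vs xs; rewrite /tall /profile has_map; apply/hasP.
by exists x; rewrite ?desc_self.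
Qed.

Lemma tall_parent s y k : valid s -> 0 < y <= size s ->
  tall k (profile y s) -> tall k.+1 (profile (parent s y) s).
Proof.
move=> vs ys; rewrite /tall /profile !has_map => /hasP[z zy /= kz].
have pys := parent_lt vs ys.
apply/hasP; exists z => /=.
  apply: desc_trans zy => //; rewrite mem_desc //; last lia.
  by rewrite desc_self ?andbT //; lia.
by have := depth_parent vs ys; have := depth_desc vs zy; lia.
Qed.

Lemma tall_child s x k : valid s -> tall k.+1 (profile x s) ->
  exists2 y, (0 < y <= size s) && (parent s y == x) & tall k (profile y s).
Proof.
move=> vs; rewrite /tall /profile has_map => /hasP[z zx /= kz].
have zNx : z != x by apply: contraTneq kz => ->; lia.
have [y /andP[ys /eqP pyx] zy] := desc_child vs zx zNx.
exists y; first by rewrite ys pyx eqxx.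
rewrite has_map; apply/hasP; exists z => //=.
by have := depth_parent vs ys; rewrite pyx; lia.
Qed.

Lemma desc_root s : valid s -> desc 0 s = rev (iota 0 (size s).+1).
Proof.
elim: s => [//|i s IHs] /= /andP[ile vs].
rewrite mem_desc // (_ : (i == 0) || _ = true); last first.
  case: (posnP i) => //= i0; rewrite IHs // mem_rev mem_iota.
  by have := @parent_lt s i vs; lia.
rewrite IHs // -[RHS]/(rev (iota 0 (size s).+2)).
by rewrite -[(size s).+2]addn1 iotaD rev_cat.
Qed.

Lemma profile_root s : valid s ->
  profile 0 s = [seq depth s y | y <- rev (iota 0 (size s).+1)].
Proof.
move=> vs; rewrite /profile desc_root //; apply: eq_map => y.
suff -> : depth s 0 = 0 by rewrite subn0.
by elim: (s).
Qed.

Lemma size_profile_root s : valid s -> size (profile 0 s) = (size s).+1.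
Proof. by move=> vs; rewrite profile_root // size_map size_rev size_iota. Qed.

Lemma profile_new s i : valid (i :: s) -> profile (size s).+1 (i :: s) = [:: 0].
Proof.
move=> vs; rewrite /profile /= eqxx /= eqxx subnn; congr (_ :: _).
suff -> : desc (size s).+1 s = [::] by [].
by apply/eqP; rewrite -size_eq0 -leqn0 leqNgt -has_predT; apply/hasPn => y
  /desc_range; lia.
Qed.

(** Attaching a node to [i] replaces the profile [l] of [x] by [d.+1 :: l], with
[d] the entry of [i] in [l], if [i] lies below [x], and leaves it alone
otherwise. Hence a uniform choice of [i] amounts to a uniform choice of an entry
of [l], with probability the proportion of descendants of [x]. *)
Lemma profile_step s x i : valid (i :: s) -> x <= size s ->
  profile x (i :: s) =
  if i \in desc x s then (depth s i - depth s x).+1 :: profile x s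
  else profile x s.
Proof.
move=> /= /andP[ile vs] xs; rewrite /profile /=.
have -> : ((size s).+1 == x) = false by lia.
have -> : (x == (size s).+1) = false by lia.
have same :
    [seq (if y == (size s).+1 then (depth s i).+1 else depth s y) - depth s x
       | y <- desc x s] = [seq depth s y - depth s x | y <- desc x s].
  by apply/eq_in_map => y /desc_range ys; rewrite ifN //; lia.
rewrite /=; case: ifP => // ix /=; rewrite eqxx same; congr (_ :: _).
by have := depth_desc vs ix; lia.
Qed.

(** * Stripping leaves from a recursive tree *)

Section StripTree.
Variables (n : nat) (s : seq nat) (e : rel 'I_n.+1).
Hypotheses (valid_s : valid s) (size_s : size s = n).
Hypothesis edgeE : forall x y : 'I_n.+1,
  e x y = (0 < x) && (parent s x == y) || (0 < y) && (parent s y == x).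

Implicit Types (x y z : 'I_n.+1) (A : {set 'I_n.+1}).

Let up x : 'I_n.+1 := inord (parent s x).

Let node_le x : x <= size s. Proof. by rewrite size_s -ltnS. Qed.

Lemma node_parent_lt x : 0 < x -> parent s x < x.
Proof. by move=> x0; apply: parent_lt; rewrite ?x0 ?node_le. Qed.

Let upE x : 0 < x -> up x = parent s x :> nat.
Proof. by move=> x0; rewrite inordK // (ltn_trans (node_parent_lt x0)). Qed.

Let edge_up x : 0 < x -> e x (up x).
Proof. by move=> x0; rewrite edgeE x0 upE ?eqxx. Qed.

Let e_sym x y : e x y = e y x. Proof. by rewrite !edgeE orbC. Qed.

Let parent_child_neq x y z :
  0 < x -> parent s x = z -> parent s y = x -> 0 < y -> y != z.
Proof.
move=> x0 xz yx y0; apply/eqP => yz.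
by have := node_parent_lt x0; have := node_parent_lt y0; rewrite xz yx yz; lia.
Qed.

Lemma not_leaf2 A x y z :
  y \in A -> z \in A -> e x y -> e x z -> y != z -> ~~ is_leaf e A x.
Proof.
move=> yA zA xy xz yz; rewrite /is_leaf negb_and; apply/orP; right.
rewrite negb_or; apply/andP; split.
  have : #|[set y; z]| <= degree_in e A x.
    apply/subset_leq_card/fintype.subsetP => t; rewrite !inE => /orP[]/eqP ->.
      by rewrite yA.
    by rewrite zA.
  by rewrite cards2 yz; lia.
apply/eqP => Ax; move: yz yA zA.
by rewrite Ax !inE => /eqP yz /eqP yx /eqP zx; apply: yz; rewrite yx zx.
Qed.

Lemma in_strip A x : (x \in strip e A) = ~~ is_leaf e A x && (x \in A).
Proof. by rewrite !inE. Qed.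

(** A node of depth at least [k.+1] whose fringe subtree has height at least
[k.+1] has two neighbours to which the induction hypothesis applies: its parent,
and a child at the top of a tallest branch. So it is not a leaf after [k]
rounds. *)
Lemma tall_strip k x : k <= depth s x -> tall k (profile x s) ->
  x \in iter k (strip e) [set: _].
Proof.
elim: k x => [|k IHk] x kx tx; first by rewrite inE.
have le_tall j l : tall j.+1 l -> tall j l by apply: sub_has => d /=; lia.
have x0 : 0 < x.
  by rewrite lt0n; apply: contraTneq kx => ->; elim: (s).
have x0s : 0 < x <= size s by rewrite x0 node_le.
rewrite iterS in_strip IHk ?andbT //; [|exact: ltnW|exact: le_tall].
have [y0 /andP[y0s /eqP yx] ty] := tall_child valid_s tx.
have yn : y0 < n.+1 by rewrite ltnS -size_s; lia.
pose y := Ordinal yn.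
have dx := depth_parent valid_s x0s; have dy := depth_parent valid_s y0s.
apply: (@not_leaf2 _ _ (up x) y).
- apply: IHk; rewrite upE //; first lia.
  by apply/le_tall/le_tall/tall_parent.
- by apply: IHk => //=; rewrite dy yx; lia.
- exact: edge_up.
- by rewrite edgeE /= yx eqxx andbT; apply/orP; right; lia.
- rewrite eq_sym; apply: (@parent_child_neq x) => //=; last lia.
  by rewrite upE.
Qed.

(** Connectedness of a set of nodes, phrased as having a single topmost node
[r]. If [A] is nonempty then [r] is its least node; the empty set, which is what
remains in the end, counts as connected. *)
Definition rooted A := exists r, forall x, x \in A -> x != r ->
  0 < x /\ up x \in A.

Lemma rootedT : rooted [set: _].
Proof.
exists ord0 => x _ x0; split; last by rewrite inE.
by rewrite lt0n.
Qed.

(** A node with both its parent and a child in [A] is not a leaf, so only the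
top can be a stripped node with children left. If the top [r] is stripped, it
has a single neighbour [y] in [A], and [y] becomes the top. *)
Lemma rooted_strip A : rooted A -> rooted (strip e A).
Proof.
case=> r topr.
have inner x : x \in A -> x != r -> up x != r ->
    0 < x /\ up x \in strip e A.
  move=> xA xr pr; have [x0 pA] := topr x xA xr.
  split=> //; have [p0 ppA] := topr _ pA pr.
  rewrite in_strip pA andbT; apply: not_leaf2 xA ppA _ (edge_up p0) _.
    by rewrite e_sym edge_up.
  by apply: (@parent_child_neq (up x)) => //; exact/esym/upE.
have [rleaf|rN] := boolP (is_leaf e A r); last first.
  exists r => x; rewrite in_strip => /andP[_ xA] xr.
  have [pr|pr] := eqVneq (up x) r; last exact: inner.
  by have [x0 pA] := topr x xA xr; rewrite in_strip pA pr rN.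
have rN : r \notin strip e A by rewrite in_strip rleaf.
case/andP: (rleaf) => rA /orP[/cards1P[y Ey]|/eqP Ar].
  (* [y] itself may be stripped too; it serves as the absent top of an empty
     set in that case. *)
  exists y => x xS xy; have xr : x != r by apply: contraNneq rN => <-.
  move: (xS); rewrite in_strip => /andP[_ xA].
  apply: inner => //; apply: contraNneq xy => pr.
  rewrite -finset.in_set1 -Ey inE xA -pr e_sym edge_up //.
  by have [] := topr x xA xr.
exists r => x; rewrite in_strip => /andP[xN xA].
by move: xA; rewrite {1}Ar inE => ->.
Qed.

(** This is where connectedness is needed: a node of degree 0 in [A] that is not
the whole of [A] is not a leaf either, and would survive forever. *)
Lemma rooted_child A x : rooted A -> x \in A -> ~~ is_leaf e A x ->
  exists2 y, y \in A & (0 < y) && (parent s y == x).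
Proof.
case=> r topr xA; rewrite /is_leaf xA /= negb_or => /andP[deg1 AN].
have [xr|xr] := eqVneq x r.
  have /existsP[y0 yP] : [exists y, (y \in A) && (y != x)].
    apply: contraNT AN => /existsPn noY; apply/eqP/setP => y; rewrite inE.
    have [->//|yx] := eqVneq y x.
    by have := noY y; rewrite yx andbT => /negPf.
  (* The least node of [A] other than the top [x] is a child of [x]. *)
  have [y /andP[yA yx] miny] :=
    @arg_minnP _ y0 [pred y | (y \in A) && (y != x)] (@nat_of_ord _) yP.
  have yr : y != r by rewrite -xr.
  have [y0' pA] := topr y yA yr.
  exists y => //; rewrite y0' -upE //.
  apply/eqP; congr (nat_of_ord _); apply/eqP/negPn/negP => px.
  have := miny (up y); rewrite /= pA px upE // leqNgt node_parent_lt //.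
  by move=> /(_ isT).
have [x0 pA] := topr x xA xr.
have pN : up x \in [set y in A | e x y] by rewrite inE pA edge_up.
have /existsP[y] : [exists y, (y \in [set y in A | e x y]) && (y != up x)].
  apply: contraNT deg1 => /existsPn noY; apply/cards1P; exists (up x).
  apply/setP => y; rewrite [RHS]inE; have [->//|yx] := eqVneq y (up x).
  by have := noY y; rewrite yx andbT => /negPf.
rewrite inE edgeE => /andP[/andP[yA /orP[|yx]]]; last by exists y.
by rewrite -upE // => /andP[_ /eqP/val_inj ->]; rewrite eqxx.
Qed.

Lemma rooted_iter k : rooted (iter k (strip e) [set: _]).
Proof. by elim: k => [|k IHk]; [exact: rootedT | exact: rooted_strip]. Qed.

Lemma strip_tall k x : x \in iter k (strip e) [set: _] -> tall k (profile x s).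
Proof.
elim: k x => [|k IHk] x; first by move=> _; apply: tall0.
rewrite iterS in_strip => /andP[xN xA].
have [y yA /andP[y0 /eqP yx]] := rooted_child (rooted_iter k) xA xN.
by rewrite -yx; apply: tall_parent (IHk y yA); rewrite ?y0 ?node_le.
Qed.

End StripTree.

(** * The random recursive tree as a growth process *)

Fixpoint hist (g : nat -> nat) (n : nat) : seq nat :=
  if n is m.+1 then g m.+1 :: hist g m else [::].

Lemma size_hist g n : size (hist g n) = n.
Proof. by elim: n => //= n ->. Qed.

Lemma eq_hist g h n :
  (forall t, 0 < t <= n -> g t = h t) -> hist g n = hist h n.
Proof.
elim: n => //= n IHn gh; rewrite gh ?leqnn // IHn // => t /andP[t0 tn].
by rewrite gh // t0 leqW.
Qed.

Lemma valid_hist g n : (forall t, 0 < t <= n -> g t < t) -> valid (hist g n).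
Proof.
elim: n => //= n IHn gt; rewrite size_hist -ltnS gt ?leqnn //=.
by apply: IHn => t tn; apply: gt; lia.
Qed.

Lemma parent_hist g n y : 0 < y <= n -> parent (hist g n) y = g y.
Proof.
elim: n => /= [|n IHn] yn; first by lia.
by rewrite size_hist; case: eqP => [->//|yN]; apply: IHn; lia.
Qed.

(** The root has no entry: its choice in ['I_1] carries no information. *)
Definition choice_hist n (c : choices n.+1) : seq nat :=
  hist (fun t => c (inord t)) n.

Lemma size_choice_hist n (c : choices n.+1) : size (choice_hist c) = n.
Proof. exact: size_hist. Qed.

Lemma valid_choice_hist n (c : choices n.+1) : valid (choice_hist c).
Proof.
apply: valid_hist => t /andP[t0 tn].
have tE : (inord t : 'I_n.+1) = t :> nat by rewrite inordK.
by have := ltn_ord (c (inord t)); lia.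
Qed.

Lemma choice_edge n (c : choices n.+1) (x y : 'I_n.+1) :
  rrt_edge c x y = (0 < x) && (parent (choice_hist c) x == y)
                || (0 < y) && (parent (choice_hist c) y == x).
Proof.
have parentc (z : 'I_n.+1) : 0 < z -> parent (choice_hist c) z = c z.
  move=> z0; rewrite parent_hist; last by rewrite z0 -ltnS ltn_ord.
  by rewrite inord_val.
rewrite /rrt_edge /attached /=.
congr (_ || _); first by case: (posnP x) => // /parentc ->.
by case: (posnP y) => // /parentc ->.
Qed.

(** Trees with [n.+2] nodes correspond to trees with [n.+1] nodes and a choice
for the new node. The types ['I_(t.-1.+1)] of the choices vary with [t], and
[inord] moves a choice between types that are equal only propositionally. *)
Definition extend n (c : choices n.+1) (i : 'I_n.+1) : choices n.+2 :=
  [ffun t : 'I_n.+2 =>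
     (inord (if t == n.+1 :> nat then i : nat else c (inord t))
       : 'I_(t.-1.+1))].

Definition restrict n (c : choices n.+2) : choices n.+1 :=
  [ffun t : 'I_n.+1 => (inord (c (inord t)) : 'I_(t.-1.+1))].

Definition newest n (c : choices n.+2) : 'I_n.+1 := c ord_max.

Lemma extend_old n (c : choices n.+1) i (t : nat) :
  t <= n -> extend c i (inord t) = c (inord t) :> nat.
Proof.
move=> tn; have tE2 : (inord t : 'I_n.+2) = t :> nat by rewrite inordK //; lia.
have tE1 : (inord t : 'I_n.+1) = t :> nat by rewrite inordK.
rewrite ffunE tE2 ifN; last lia.
by rewrite inordK //; have := ltn_ord (c (inord t)); lia.
Qed.

Lemma extend_new n (c : choices n.+1) i : extend c i ord_max = i :> nat.
Proof. by rewrite ffunE /= eqxx inord_val. Qed.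

Lemma choice_val n (c : choices n) (t u : 'I_n) : t = u -> c t = c u :> nat.
Proof. by move->. Qed.

Lemma extendK n : cancel (fun p : choices n.+1 * 'I_n.+1 => extend p.1 p.2)
                         (fun c => (restrict c, newest c)).
Proof.
move=> [c i]; congr pair; last by apply/val_inj; rewrite /= extend_new.
apply/ffunP => t; apply/val_inj; rewrite /= ffunE /=.
have tn : t <= n by rewrite -ltnS.
rewrite extend_old //.
have -> : c (inord t) = c t :> nat by apply: choice_val; rewrite inord_val.
by rewrite inord_val.
Qed.

Lemma restrictK n : cancel (fun c => (restrict c, newest c))
                           (fun p : choices n.+1 * 'I_n.+1 => extend p.1 p.2).
Proof.
move=> c; apply/ffunP => t; apply/val_inj => /=.
have [tn|tn] := eqVneq (t : nat) n.+1.
  have -> : t = ord_max by apply/val_inj.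
  by rewrite extend_new.
have tn' : t <= n by have := ltn_ord t; lia.
have tE : (inord t : 'I_n.+2) = t by rewrite inord_val.
rewrite -(choice_val (extend _ _) tE).
rewrite extend_old // ffunE.
have -> : c (inord (inord t : 'I_n.+1)) = c t :> nat.
  by apply: choice_val; apply: val_inj; rewrite /= inordK inordK.
by rewrite inordK //= inordK // ltn_ord.
Qed.

Lemma hist_extend n (c : choices n.+1) i :
  choice_hist (extend c i) = (i : nat) :: choice_hist c.
Proof.
rewrite /choice_hist /=; congr cons.
  rewrite -[RHS](extend_new c); apply: choice_val.
  by apply: val_inj; rewrite /= inordK.
by apply: eq_hist => t tn; rewrite extend_old //; lia.
Qed.

Local Open Scope ring_scope.

(** The expectation of [f] over histories of length [n], that is, over random
recursive trees with [n.+1] nodes, by conditioning on the last choice. *)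
Fixpoint Etree (R : realType) (n : nat) (f : seq nat -> R) : R :=
  if n is m.+1 then
    Etree m (fun s => m.+1%:R^-1 * \sum_(i < m.+1) f ((i : nat) :: s))
  else f [::].

Lemma rrt_expect_hist (R : realType) n (f : seq nat -> R) :
  rrt_expect (fun c : choices n.+1 => f (choice_hist c)) = Etree n f.
Proof.
elim: n f => [|n IHn] f /=.
  rewrite /rrt_expect.
  pose c0 : choices 1 := [ffun t : 'I_1 => (ord0 : 'I_(t.-1.+1))].
  have uniq1 (c : choices 1) : c = c0.
    apply/ffunP => t; apply/val_inj; rewrite ffunE /=.
    by have := ltn_ord (c t); have := ltn_ord t; lia.
  rewrite (big_pred1 c0) => [|c]; last first.
    by apply/esym/eqP/uniq1.
  by rewrite /rrt_prob big_mkcond big_ord1 mul1r.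
rewrite -IHn /rrt_expect.
rewrite (reindex (fun p : choices n.+1 * 'I_n.+1 => extend p.1 p.2)) /=;
  last first.
  exists (fun c => (restrict c, newest c)) => p _.
    exact: extendK.
  exact: restrictK.
rewrite -(pair_bigA _ (fun c i =>
  rrt_prob R (extend c i) * f (choice_hist (extend c i)))) /=.
apply: eq_bigr => c _; rewrite mulrA mulr_sumr; apply: eq_bigr => i _.
rewrite hist_extend; congr (_ * _).
rewrite /rrt_prob big_mkcond big_ord_recr /= -big_mkcond /=; congr (_ * _).
Qed.

Section Expectation.
Variable R : realType.
Implicit Types (f g : seq nat -> R) (s l : seq nat).

Lemma Etree_le n f g :
  (forall s, valid s -> size s = n -> f s <= g s) -> Etree n f <= Etree n g.
Proof.
elim: n f g => [|n IHn] f g fg /=; first exact: fg.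
apply: IHn => s vs ss; rewrite ler_wpM2l ?invr_ge0 //.
apply: ler_sum => i _; apply: fg; rewrite /= ?vs ?ss //.
by rewrite -ltnS ltn_ord.
Qed.

Lemma eq_Etree n f g :
  (forall s, valid s -> size s = n -> f s = g s) -> Etree n f = Etree n g.
Proof.
by move=> fg; apply/le_anti/andP; split; apply: Etree_le => s vs ss; rewrite fg.
Qed.

Lemma EtreeD n f g : Etree n (fun s => f s + g s) = Etree n f + Etree n g.
Proof.
elim: n f g => //= n IHn f g; rewrite -IHn; apply: eq_Etree => s _ _.
by rewrite -mulrDr -big_split.
Qed.

Lemma EtreeZ n a f : Etree n (fun s => a * f s) = a * Etree n f.
Proof.
elim: n f => //= n IHn f; rewrite -IHn; apply: eq_Etree => s _ _.
by rewrite -mulr_sumr mulrCA.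
Qed.

Lemma Etree_cst n (a : R) : Etree n (fun=> a) = a.
Proof.
elim: n => //= n IHn; rewrite -[RHS]IHn; apply: eq_Etree => s _ _.
by rewrite sumr_const card_ord -[a *+ _]mulr_natl mulKf // pnatr_eq0.
Qed.

Lemma sum_profile_step s x f : valid s -> (x <= size s)%N ->
  \sum_(i < (size s).+1) f (profile x ((i : nat) :: s)) =
  ((size s).+1%:R - (size (profile x s))%:R) * f (profile x s) +
  \sum_(d <- profile x s) f (d.+1 :: profile x s).
Proof.
move=> vs xs; set P := profile x s; set D := desc x s.
pose F i := f ((depth s i - depth s x)%N.+1 :: P) - f P.
transitivity
  (\sum_(i < (size s).+1) (f P + if (i : nat) \in D then F i else 0)).
  apply: eq_bigr => i _; rewrite profile_step //=; last first.
    by rewrite vs -ltnS ltn_ord.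
  by rewrite -/D -/P; case: ifP => _; rewrite ?addr0 // addrC subrK.
rewrite big_split /= sumr_const card_ord -[_ *+ _]mulr_natl.
rewrite -(big_mkord xpredT (fun i => if i \in D then F i else 0)) -big_mkcond.
rewrite -big_filter (perm_big D); last first.
  apply: uniq_perm; rewrite ?filter_uniq ?iota_uniq ?desc_uniq // => y.
  rewrite mem_filter; case: (boolP (y \in D)) => //= /desc_range ys.
  by rewrite mem_index_iota; lia.
rewrite /F big_split /= sumrN big_const_seq count_predT iter_addr_0.
have -> : size P = size D by rewrite size_map.
by rewrite big_map -(mulr_natl (f P)); ring.
Qed.
End Expectation.

(** * The law of the fringe subtrees *)

Section Profile.
Variable R : realType.
Implicit Types (f g : seq nat -> R) (s l : seq nat).

Definition Eprof (n : nat) f : R := Etree n (fun s => f (profile 0 s)).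

Lemma Eprof_le n f g :
  (forall l, size l = n.+1 -> f l <= g l) -> Eprof n f <= Eprof n g.
Proof.
move=> fg; apply: Etree_le => s vs ss.
by apply: fg; rewrite size_profile_root ?ss.
Qed.

Lemma eq_Eprof n f g :
  (forall l, size l = n.+1 -> f l = g l) -> Eprof n f = Eprof n g.
Proof.
move=> fg; apply: eq_Etree => s vs ss.
by apply: fg; rewrite size_profile_root ?ss.
Qed.

Lemma EprofD n f g : Eprof n (fun l => f l + g l) = Eprof n f + Eprof n g.
Proof. exact: EtreeD. Qed.

Lemma EprofZ n (a : R) f : Eprof n (fun l => a * f l) = a * Eprof n f.
Proof. exact: EtreeZ. Qed.

Lemma Eprof_cst n (a : R) : Eprof n (fun=> a) = a.
Proof. exact: Etree_cst. Qed.

Lemma Eprof0 f : Eprof 0 f = f [:: 0%N].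
Proof. by []. Qed.

Lemma EprofS n f :
  Eprof n.+1 f = Eprof n (fun l => n.+1%:R^-1 * \sum_(d <- l) f (d.+1 :: l)).
Proof.
rewrite /Eprof /=; apply: eq_Etree => s vs <-; congr (_ * _).
by rewrite sum_profile_step // size_profile_root // subrr mul0r add0r.
Qed.

(** The induction step of [fringe_expect]: with [a m] the mean of a functional
over random recursive trees with [m.+1] nodes, the weights 1 / (m (m + 1)) are
stationary for the growth of a fringe subtree. *)
Lemma fringe_weights (a : nat -> R) n :
  a 0%N + \sum_(m < n) ((n%:R - m%:R) * a m + m.+1%:R * a m.+1)
                        / (m.+1%:R * m.+2%:R) =
  n.+2%:R * \sum_(m < n.+1) a m / (m.+1%:R * m.+2%:R).
Proof.
have nz m : m.+1%:R != 0 :> R by rewrite pnatr_eq0.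
transitivity (\sum_(m < n.+1) (n%:R - m%:R) * a m / (m.+1%:R * m.+2%:R) +
              \sum_(m < n.+1) a m / m.+1%:R).
  rewrite big_ord_recr /= subrr !mul0r addr0.
  rewrite [X in _ = _ + X]big_ord_recl /= divr1 addrCA -big_split /=.
  congr (_ + _); apply: eq_bigr => m _; rewrite mulrDl; congr (_ + _).
  by rewrite /bump /= add1n -mulf_div divff ?mul1r.
rewrite -big_split mulr_sumr /=; apply: eq_bigr => m _.
have := nz m; have := nz m.+1; rewrite -!natr1 => nz2 nz1.
by field; rewrite nz1 nz2.
Qed.

(** At every finite size, the mean number of fringe subtrees with [m.+1] nodes,
root excluded, is [n.+1%:R / (m.+1%:R * m.+2%:R)] for [m < n], and each of them
is a random recursive tree. The induction on [n] is for all [f] at once: one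
step of growth turns [f] into the functional [g]. *)
Lemma fringe_expect n f :
  Etree n (fun s => \sum_(x < n) f (profile x.+1 s)) =
  n.+1%:R * \sum_(m < n) Eprof m f / (m.+1%:R * m.+2%:R).
Proof.
elim: n f => [|n IHn] f; first by rewrite /= !big_ord0 mulr0.
have nz m : m.+1%:R != 0 :> R by rewrite pnatr_eq0.
pose g l := n.+1%:R^-1 * ((n.+1%:R - (size l)%:R) * f l +
                          \sum_(d <- l) f (d.+1 :: l)).
transitivity (Etree n (fun s => \sum_(x < n) g (profile x.+1 s) + f [:: 0%N])).
  rewrite [LHS]/=; apply: eq_Etree => s vs ss.
  rewrite exchange_big big_ord_recr /= mulrDr; congr (_ + _).
    rewrite mulr_sumr; apply: eq_bigr => x _; rewrite /g; congr (_ * _).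
    have xs : (x.+1 <= size s)%N by rewrite ss.
    by have := sum_profile_step f vs xs; rewrite ss.
  transitivity (n.+1%:R^-1 * \sum_(i < n.+1) f [:: 0%N]).
    congr (_ * _); apply: eq_bigr => i _; rewrite -{1}ss profile_new //=.
    by rewrite vs ss -ltnS ltn_ord.
  by rewrite sumr_const card_ord -[f _ *+ _]mulr_natl mulKf.
rewrite EtreeD Etree_cst IHn -(fringe_weights (fun m => Eprof m f)).
rewrite addrC Eprof0.
congr (_ + _).
rewrite mulr_sumr; apply: eq_bigr => m _; rewrite mulrA; congr (_ / _).
rewrite EprofS -!EprofZ -EprofD; apply: eq_Eprof => l sl.
rewrite /g sl mulrA mulfV // mul1r mulrA mulfV // mul1r.
by rewrite -!natr1; ring.
Qed.

(** * Heights of random recursive trees *)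

(** A new node attached at depth [d] contributes [z ^+ d.+1], so each step
multiplies the mean of the generating function of the depths by
[1 + z / i.+1%:R]. *)
Lemma Eprof_pow n (z : R) :
  Eprof n (fun l => \sum_(d <- l) z ^+ d) = \prod_(i < n) (1 + z / i.+1%:R).
Proof.
elim: n => [|n IHn]; first by rewrite Eprof0 big_seq1 expr0 big_ord0.
rewrite EprofS big_ord_recr /= -IHn mulrC -EprofZ; apply: eq_Eprof => l sl.
under eq_bigr do rewrite big_cons exprS.
rewrite big_split -mulr_sumr /= big_const_seq count_predT iter_addr_0 sl.
have nz : n.+1%:R != 0 :> R by rewrite pnatr_eq0.
by rewrite -[(\sum_(d <- l) _) *+ _]mulr_natl; field.
Qed.

(** From [ln (1 - x) <= - x] at [x = n.+2%:R^-1]. *)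
Lemma harmonic_le_ln n : \sum_(i < n) i.+1%:R^-1 <= 1 + ln n.+1%:R :> R.
Proof.
case: n => [|n]; first by rewrite big_ord0 ln1 addr0.
apply: (@le_trans _ _ (1 + ln n.+1%:R)); last first.
  by rewrite lerD2l ler_ln ?posrE ?ltr0n // ler_nat.
elim: n => [|n IHn]; first by rewrite big_ord1 ln1 addr0 invr1.
rewrite big_ord_recr /=.
suff ln_step : n.+2%:R^-1 <= ln n.+2%:R - ln n.+1%:R :> R.
  by apply: le_trans (lerD IHn ln_step) _; lra.
rewrite -opprB lerNr -ln_div ?posrE ?ltr0n //.
have -> : n.+1%:R / n.+2%:R = 1 + - n.+2%:R^-1 :> R.
  have -> : n.+1%:R = n.+2%:R - 1 :> R by rewrite -[n.+2%:R]natr1 addrK.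
  by rewrite mulrBl divff ?pnatr_eq0 // mul1r.
by apply: le_ln1Dx; rewrite ltrN2 invf_lt1 ?ltr0n // ltr1n.
Qed.

Lemma Eprof_pow_le n (z : R) : 0 <= z ->
  Eprof n (fun l => \sum_(d <- l) z ^+ d) <= expR (z * (1 + ln n.+1%:R)).
Proof.
move=> z0; rewrite Eprof_pow.
apply: (@le_trans _ _ (\prod_(i < n) expR (z / i.+1%:R))).
  apply: ler_prod => i _; rewrite expR_ge1Dx andbT addr_ge0 //.
  by rewrite divr_ge0.
rewrite -expR_sum ler_expR -mulr_sumr ler_wpM2l //; exact: harmonic_le_ln.
Qed.

Definition tall_prob k m : R := Eprof m (fun l => (tall k l)%:R).

Lemma tall_prob_ge0 k m : 0 <= tall_prob k m.
Proof. by rewrite -(Eprof_cst m 0); apply: Eprof_le => l _. Qed.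

Lemma tall_prob_le1 k m : tall_prob k m <= 1.
Proof. by rewrite -(Eprof_cst m 1); apply: Eprof_le => l _; case: tall. Qed.

(** Markov's inequality for the generating function of the depths. *)
Lemma tall_prob_le k m (z : R) : 1 <= z ->
  tall_prob k m <= expR (z * (1 + ln m.+1%:R)) / z ^+ k.
Proof.
move=> z1; have z0 : 0 < z by apply: lt_le_trans z1.
rewrite mulrC.
apply: (@le_trans _ _ (z ^- k * Eprof m (fun l => \sum_(d <- l) z ^+ d))).
  rewrite -EprofZ; apply: Eprof_le => l _.
  have sum0 (r : seq nat) : 0 <= \sum_(d <- r) z ^+ d.
    by apply: sumr_ge0 => d _; rewrite exprn_ge0 // ltW.
  case: (boolP (tall k l)) => [|_]; last first.
    by rewrite mulr_ge0 // invr_ge0 exprn_ge0 // ltW.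
  move=> /hasP[d dl kd]; rewrite mulrC ler_pdivlMr ?exprn_gt0 // mul1r.
  rewrite (big_rem d) //= (@le_trans _ _ (z ^+ d)) ?lerDl //.
  by rewrite ler_weXn2l.
apply: ler_wpM2l; first by rewrite invr_ge0 exprn_ge0 // ltW.
exact/Eprof_pow_le/ltW.
Qed.

End Profile.

(** * Bounds on the proportion of tall fringe subtrees *)

Section Tails.
Variable R : realType.

(** By [fringe_expect], the expected number of nodes other than the root whose
fringe subtree has height at least [k], in a tree with [n.+1] nodes, divided by
[n.+1]. *)
Definition fringe_sum k n : R :=
  \sum_(m < n) tall_prob R k m / (m.+1%:R * m.+2%:R).

Lemma nat1_neq0 m : m.+1%:R != 0 :> R. Proof. by rewrite pnatr_eq0. Qed.

Lemma sum_weights M n :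
  \sum_(m < n) ((M + m).+1%:R * (M + m).+2%:R)^-1 =
  M.+1%:R^-1 - (M + n).+1%:R^-1 :> R.
Proof.
elim: n => [|n IHn]; first by rewrite big_ord0 addn0 subrr.
rewrite big_ord_recr /= IHn addnS; move: (M + n)%N => q.
have := nat1_neq0 q; have := nat1_neq0 q.+1; have := nat1_neq0 M.
by rewrite -!natr1 => nz nz2 nz1; field; rewrite nz1 nz2 nz.
Qed.

Lemma fringe_sum_nd k : nondecreasing_seq (fringe_sum k).
Proof.
apply/nondecreasing_seqP => n; rewrite /fringe_sum big_ord_recr lerDl.
by rewrite divr_ge0 // tall_prob_ge0.
Qed.

Lemma fringe_sum_ge0 k n : 0 <= fringe_sum k n.
Proof. by apply: sumr_ge0 => m _; rewrite divr_ge0 // tall_prob_ge0. Qed.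

(** Up to [m = exp(k / e)] each term is at most exp(e - 2 k / e) by
[tall_prob_le] at z = e, because m ^ (e - 2) is largest at the cut-off. The later
terms telescope. *)
Lemma fringe_sum_upper k n :
  fringe_sum k n <= (expR (expR 1) + 1) * expR (- (k%:R / expR 1)).
Proof.
set e := expR 1; set X := expR (k%:R / e).
have e0 : 0 < e by exact: expR_gt0.
have e2 : 2 <= e by have := expR_ge1Dx (1 : R); rewrite -/e; lra.
have X0 : 0 < X by exact: expR_gt0.
have /andP[MX XM] := truncn_itv (ltW X0).
set M := Num.truncn X in MX XM.
apply: (@le_trans _ _ (fringe_sum k (M + n))).
  by apply: fringe_sum_nd; rewrite leq_addl.
rewrite /fringe_sum big_split_ord /= mulrDl mul1r lerD //; last first.
  apply: (@le_trans _ _ (M.+1%:R^-1)); last first.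
    by rewrite expRN -/X lef_pV2 ?posrE ?ltr0n // ltW.
  apply: (@le_trans _ _ (\sum_(m < n) ((M + m).+1%:R * (M + m).+2%:R)^-1)).
    apply: ler_sum => m _; rewrite ler_piMl ?tall_prob_le1 //.
  by rewrite sum_weights gerBl.
apply: (@le_trans _ _ (\sum_(m < M) expR (e - 2 * (k%:R / e)))).
  apply: ler_sum => m _; set L := ln (m.+1%:R : R).
  have mL : expR L = m.+1%:R by rewrite lnK // posrE ltr0n.
  have LX : L <= k%:R / e.
    rewrite -ler_expR mL -/X; apply: le_trans MX.
    by rewrite ler_nat ltn_ord.
  (* With L = ln (m + 1), the weight is at most exp(- 2 L). *)
  apply: (@le_trans _ _ (expR (e * (1 + L)) / e ^+ k / (expR L * expR L))).
    apply: ler_pM; rewrite ?tall_prob_ge0 ?invr_ge0 //.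
      by apply: tall_prob_le; lra.
    by rewrite mL lef_pV2 ?posrE ?mulr_gt0 ?ltr0n // ler_wpM2l // ler_nat.
  rewrite /e -expRM_natr mul1r -/e -expRD -!expRB ler_expR.
  have : (e - 2) * L <= (e - 2) * (k%:R / e) by rewrite ler_wpM2l // subr_ge0.
  have : e * (k%:R / e) = k%:R by rewrite mulrC divfK // gt_eqF.
  by lra.
rewrite sumr_const card_ord -[_ *+ M]mulr_natl.
apply: (@le_trans _ _ (X * expR (e - 2 * (k%:R / e)))).
  by rewrite ler_wpM2r // expR_ge0.
by rewrite -!expRD ler_expR; lra.
Qed.

Definition deep_count k m : R := Eprof m (fun l => (count (leq k) l)%:R).

Lemma deep_count_le k m : deep_count k m <= m.+1%:R * tall_prob R k m.
Proof.
rewrite -EprofZ; apply: Eprof_le => l sl; rewrite /tall has_count.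
case: (posnP (count _ l)) => [->|_]; first by rewrite mulr0.
by rewrite mulr1 ler_nat -sl count_size.
Qed.

Lemma deep_count_size k m : deep_count k m <= m.+1%:R.
Proof.
apply: le_trans (deep_count_le k m) _.
by rewrite ler_piMr // tall_prob_le1.
Qed.

Lemma deep_count0 m : deep_count 0 m = m.+1%:R.
Proof.
rewrite -(Eprof_cst m m.+1%:R); apply: eq_Eprof => l sl.
by rewrite (eq_count (a2 := predT)) // count_predT sl.
Qed.

Lemma deep_countS0 k : deep_count k.+1 0 = 0.
Proof. by []. Qed.

Lemma deep_countS k m :
  deep_count k.+1 m.+1 = deep_count k.+1 m + deep_count k m / m.+1%:R.
Proof.
rewrite /deep_count EprofS mulrC -EprofZ -EprofD; apply: eq_Eprof => l sl.
have -> : \sum_(d <- l) ((count (leq k.+1) (d.+1 :: l))%:R : R) =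
          (count (leq k) l)%:R + m.+1%:R * (count (leq k.+1) l)%:R.
  under eq_bigr do rewrite /= natrD.
  rewrite big_split /= big_const_seq count_predT iter_addr_0 sl mulr_natl.
  congr (_ + _); rewrite -(sum1_count l (leq k)) natr_sum [RHS]big_mkcond.
  by apply: eq_bigr => d _; rewrite ltnS; case: leq.
by rewrite mulrDr mulKf ?nat1_neq0 // addrC.
Qed.

(** The factor [m.+1%:R], the number of nodes, turns the count of deep nodes into
a proportion. The two others form a weight slightly smaller than the one in
[fringe_sum], chosen to make [deep_sum_rec] exact. *)
Definition deep_sum k n : R :=
  \sum_(m < n) deep_count k m / (m.+1%:R * m.+2%:R * m.+3%:R).

(** Summation by parts: by [deep_countS], the proportions summed on the left are
the increments of [deep_count k.+1]. *)
Lemma deep_sum_rec k n : deep_sum k n =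
  deep_count k.+1 n / (n.+1%:R * n.+2%:R) + 2 * deep_sum k.+1 n.
Proof.
elim: n => [|n IHn].
  by rewrite /deep_sum !big_ord0 deep_countS0 mul0r mulr0 addr0.
rewrite /deep_sum !big_ord_recr /= -/(deep_sum k n) -/(deep_sum k.+1 n) IHn.
rewrite deep_countS.
have := nat1_neq0 n; have := nat1_neq0 n.+1; have := nat1_neq0 n.+2.
by rewrite -!natr1 => nz nz2 nz1; field; rewrite nz1 nz2 nz.
Qed.

(** The boundary term of [deep_sum_rec] is at most [n.+2%:R^-1], and the error
[n.+2%:R^-1] is reproduced by halving, as (q + q) / 2 = q. *)
Lemma deep_sum_lower k n : 2 ^- k / 2 - n.+2%:R^-1 <= deep_sum k n.
Proof.
elim: k => [|k IHk].
  rewrite /deep_sum expr0 invr1 mul1r.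
  have := sum_weights 1 n; rewrite !add1n -[_.+2]addn1 => sumE.
  rewrite -sumE.
  apply: ler_sum => m _.
  by rewrite deep_count0 -mulrA [in leRHS]invfM mulVKf ?nat1_neq0.
have := deep_sum_rec k n; have := deep_count_size k.+1 n => cn rec.
have bd : deep_count k.+1 n / (n.+1%:R * n.+2%:R) <= n.+2%:R^-1.
  rewrite invfM mulrA ler_piMl // ler_pdivrMr ?ltr0n //.
  by rewrite mul1r.
have halve (p q b u v : R) :
    p / 2 - q <= u -> b <= q -> u = b + 2 * v -> 2^-1 * p / 2 - q <= v.
  by move=> h1 h2 h3; lra.
by rewrite exprS invfM; apply: halve IHk bd rec.
Qed.

(** A tree of height less than [k] has no node of depth at least [k], so the
probability of height at least [k] is at least the mean proportion of such
nodes. *)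
Lemma deep_sum_le k n : deep_sum k n <= fringe_sum k n.
Proof.
apply: ler_sum => m _.
apply: (@le_trans _ _
  (m.+1%:R * tall_prob R k m / (m.+1%:R * m.+2%:R * m.+3%:R))).
  by rewrite ler_wpM2r ?deep_count_le // invr_ge0.
rewrite -!mulrA invfM mulrCA mulVKf ?nat1_neq0 // ler_wpM2l ?tall_prob_ge0 //.
rewrite lef_pV2 ?posrE ?mulr_gt0 ?ltr0n // -!natrM ler_nat.
lia.
Qed.

End Tails.

(** * From layers to fringe subtrees *)

Definition remaining n k (c : choices n) : nat :=
  #|iter k (strip (rrt_edge c)) [set: 'I_n]|.

Lemma layer_countE n k (c : choices n) :
  (layer_count k c + remaining k.+1 c)%N = remaining k c.
Proof.
rewrite /layer_count /remaining iterS /strip.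
set A := iter k _ _; rewrite -(cardsID (leaves (rrt_edge c) A) A).
congr (_ + _)%N; apply: eq_card => x.
by rewrite !inE /at_layer -/A /is_leaf; case: (x \in A).
Qed.

Definition tall_count k n (s : seq nat) : nat :=
  \sum_(x < n) tall k (profile x.+1 s).

Definition shallow_count k (s : seq nat) : nat := count (geq k) (profile 0 s).

Lemma shallow_countE n k s : valid s -> size s = n ->
  shallow_count k s = (\sum_(x < n.+1) (depth s x <= k))%N.
Proof.
move=> vs <-; rewrite /shallow_count profile_root // count_map count_rev.
rewrite -sum1_count big_mkcond.
rewrite -(big_mkord xpredT (fun x => (depth s x <= k)%N : nat)) /=.
by apply: eq_bigr => x _ /=; case: leq.
Qed.

(** Survivors of [k] rounds are tall, and tall nodes that do not survive are
shallow. The root, which [tall_count] omits, is shallow as well. *)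
Lemma remaining_bounds n k (c : choices n.+1) (s := choice_hist c) :
  (remaining k c <= tall_count k n s + shallow_count k s)%N /\
  (tall_count k n s <= remaining k c + shallow_count k s)%N.
Proof.
have vs : valid s by exact: valid_choice_hist.
have ss : size s = n by exact: size_choice_hist.
rewrite (shallow_countE k vs ss) /remaining; set A := iter k _ _.
have -> : #|A| = (\sum_(x < n.+1) (x \in A))%N.
  by rewrite -sum1_card big_mkcond; apply: eq_bigr => x _; case: (x \in A).
have sound x : x \in A -> tall k (profile x s).
  exact: (strip_tall vs ss (choice_edge c)).
have complete (x : 'I_n.+1) :
    (k <= depth s x)%N -> tall k (profile x s) -> x \in A.
  exact: (tall_strip vs ss (choice_edge c)).
rewrite !big_ord_recl /= /tall_count.
have dep0 : depth s 0 = 0%N by elim: (s).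
have shift (x : 'I_n) : lift ord0 x = x.+1 :> nat by rewrite lift0.
split.
  rewrite addnCA leq_add //; first by rewrite dep0; case: (_ \in A).
  rewrite -big_split; apply: leq_sum => x _ /=.
  case: (boolP (lift ord0 x \in A)) => // /sound.
  by rewrite shift => ->.
rewrite addnACA (leq_trans _ (leq_addl _ _)) // -big_split.
apply: leq_sum => x _ /=; case: (boolP (tall k _)) => // tx.
case: (leqP (depth s x.+1) k) => [_|kx]; first by rewrite addn1.
by rewrite (complete (lift ord0 x)) // shift // ltnW.
Qed.

Section Limits.
Local Open Scope classical_set_scope.
Variable R : realType.

Definition remaining_frac k n : R :=
  rrt_expect (fun c : choices n => (remaining k c)%:R / n%:R).

Lemma layer_fracE k n :
  layer_frac R k n = remaining_frac k n - remaining_frac k.+1 n.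
Proof.
rewrite /layer_frac /remaining_frac /rrt_expect -sumrB; apply: eq_bigr => c _.
by rewrite -mulrBr -mulrBl -(layer_countE k c) natrD addrK.
Qed.

Lemma rrt_expect_le n (X Y : choices n -> R) :
  (forall c, X c <= Y c) -> rrt_expect X <= rrt_expect Y.
Proof.
move=> XY; apply: ler_sum => c _; rewrite ler_wpM2l //.
by apply: prodr_ge0 => t _; rewrite invr_ge0.
Qed.

Definition shallow_frac k n : R :=
  Etree n (fun s => (shallow_count k s)%:R) / n.+1%:R.

Lemma tall_count_expect k n :
  Etree n (fun s => (tall_count k n s)%:R) / n.+1%:R = fringe_sum R k n.
Proof.
have -> : Etree n (fun s => (tall_count k n s)%:R) = n.+1%:R * fringe_sum R k n.
  rewrite /fringe_sum /tall_prob -fringe_expect.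
  by apply: eq_Etree => s _ _; rewrite natr_sum.
by rewrite mulrC mulKf // nat1_neq0.
Qed.

Lemma remaining_frac_dist k n :
  `|remaining_frac k n.+1 - fringe_sum R k n| <= shallow_frac k n.
Proof.
pose T s : R := (tall_count k n s)%:R / n.+1%:R.
pose L s : R := (shallow_count k s)%:R / n.+1%:R.
have expect_div (f : seq nat -> R) :
    Etree n (fun s => f s / n.+1%:R) = Etree n f / n.+1%:R.
  by rewrite mulrC -EtreeZ; apply: eq_Etree => s _ _; rewrite mulrC.
have <- : Etree n T = fringe_sum R k n.
  by rewrite -tall_count_expect; exact: expect_div.
have <- : Etree n L = shallow_frac k n by exact: expect_div.
rewrite ler_distl; apply/andP; split.
  have -> : Etree n T - Etree n L =
      rrt_expect (fun c : choices n.+1 =>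
        T (choice_hist c) + -1 * L (choice_hist c)).
    rewrite (rrt_expect_hist n (fun s => T s + -1 * L s)).
    by rewrite EtreeD EtreeZ mulN1r.
  apply: rrt_expect_le => c; rewrite mulN1r -mulrBl ler_wpM2r ?invr_ge0 //.
  by rewrite lerBlDr -natrD ler_nat; have [_] := remaining_bounds k c.
have -> : Etree n T + Etree n L =
    rrt_expect (fun c : choices n.+1 => T (choice_hist c) + L (choice_hist c)).
  by rewrite (rrt_expect_hist n (fun s => T s + L s)) EtreeD.
apply: rrt_expect_le => c; rewrite -mulrDl ler_wpM2r ?invr_ge0 //.
by rewrite -natrD ler_nat; have [] := remaining_bounds k c.
Qed.

(** A node of depth at most [k] contributes at least [2 ^- k] to the generating
function of the depths at z = 1 / 2, whose mean is only of order the square root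
of [n]. *)
Lemma shallow_frac_le k n :
  0 <= shallow_frac k n <= 2 ^+ k * expR (2^-1) * Num.sqrt (harmonic n).
Proof.
have sqrtE : Num.sqrt (harmonic n) = expR (2^-1 * ln n.+1%:R) / n.+1%:R :> R.
  have nE : n.+1%:R = expR (2^-1 * ln n.+1%:R) ^+ 2 :> R.
    by rewrite -expRM_natl mulrA mulfV ?pnatr_eq0 // mul1r lnK // posrE ltr0n.
  rewrite /= {1 3}nE -exprVn sqrtr_sqr ger0_norm ?invr_ge0 ?expR_ge0 //.
  by rewrite expr2 mulrA mulfV ?mul1r // expR_eq0.
apply/andP; split.
  rewrite divr_ge0 // -(Etree_cst n 0); apply: Etree_le => s _ _; exact: ler0n.
rewrite sqrtE mulrA /shallow_frac ler_wpM2r ?invr_ge0 // -mulrA -expRD.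
have -> : 2^-1 + 2^-1 * ln n.+1%:R = 2^-1 * (1 + ln n.+1%:R) :> R.
  by rewrite mulrDr mulr1.
have h0 : 0 <= 2^-1 :> R by rewrite invr_ge0.
apply: (@le_trans _ _ (2 ^+ k * Eprof n (fun l => \sum_(d <- l) 2^-1 ^+ d)));
  last first.
  by apply: ler_wpM2l; [exact: exprn_ge0 | exact: Eprof_pow_le].
rewrite -EprofZ; apply: (@Eprof_le _ _ (fun l => (count (geq k) l)%:R)) => l _.
rewrite -sum1_count natr_sum mulr_sumr.
rewrite big_mkcond; apply: ler_sum => d _; case: ifP => [dk|_]; last first.
  by rewrite mulr_ge0 // exprn_ge0.
rewrite exprVn ler_pdivlMr ?exprn_gt0 // mul1r ler_weXn2l //.
by rewrite ler1n.
Qed.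

Definition fringe_tail k : R := limn (fringe_sum R k).

Lemma fringe_sum_cvg k : fringe_sum R k @ \oo --> fringe_tail k.
Proof.
apply: nondecreasing_is_cvgn; first exact: fringe_sum_nd.
exists ((expR (expR 1) + 1) * expR (- (k%:R / expR 1))) => _ [n _ <-].
exact: fringe_sum_upper.
Qed.

Lemma fringe_tail_upper k :
  fringe_tail k <= (expR (expR 1) + 1) * expR (- (k%:R / expR 1)).
Proof.
apply: limr_le; first exact: fringe_sum_cvg.
by apply: nearW => n; exact: fringe_sum_upper.
Qed.

Lemma fringe_tail_ge0 k : 0 <= fringe_tail k.
Proof.
apply: limr_ge; first exact: fringe_sum_cvg.
by apply: nearW => n; exact: fringe_sum_ge0.
Qed.

Lemma fringe_tail_lower k : 2 ^- k / 2 <= fringe_tail k.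
Proof.
rewrite -subr_le0 -(cvg_lim (@Rhausdorff R) (@cvg_harmonic R)).
apply: limr_ge; first by apply: cvgP (@cvg_harmonic R).
apply: nearW => n; rewrite lerBlDr -lerBlDl.
apply: le_trans (nondecreasing_cvgn_le (@fringe_sum_nd R k) _ n);
  last exact: fringe_sum_cvg.
apply: le_trans (deep_sum_le R k n); apply: le_trans (deep_sum_lower R k n).
by rewrite lerB // /= lef_pV2 ?posrE ?ltr0n // ler_nat.
Qed.

Lemma remaining_frac_cvg k : remaining_frac k @ \oo --> fringe_tail k.
Proof.
rewrite -cvg_shiftS /=.
have err : (fun n => remaining_frac k n.+1 - fringe_sum R k n) @ \oo --> 0.
  apply/norm_cvg0P.
  have bound0 :
      (fun n => 2 ^+ k * expR (2^-1) * Num.sqrt (harmonic n)) @ \oo --> (0 : R).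
    rewrite -[X in _ --> X](mulr0 (2 ^+ k * expR (2^-1))); apply: cvgMr.
    rewrite -[X in _ --> X]sqrtr0; apply: continuous_cvg (@cvg_harmonic R).
    exact: sqrt_continuous.
  apply: squeeze_cvgr (cvg_cst (0 : R)) bound0; apply: nearW => n.
  rewrite normr_ge0 (le_trans (remaining_frac_dist k n)) //.
  by have /andP[] := shallow_frac_le k n.
rewrite -[fringe_tail k]add0r.
have -> : (fun n => remaining_frac k n.+1) =
    (fun n => remaining_frac k n.+1 - fringe_sum R k n) \+ fringe_sum R k.
  by apply/funext => n; rewrite /= subrK.
by apply: cvgD err _; exact: fringe_sum_cvg.
Qed.

Lemma layer_limE k : layer_lim R k = fringe_tail k - fringe_tail k.+1.
Proof.
apply: cvg_lim; first exact: Rhausdorff.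
have -> : layer_frac R k = remaining_frac k \- remaining_frac k.+1.
  by apply/funext => n; exact: layer_fracE.
by apply: cvgB; exact: remaining_frac_cvg.
Qed.

Lemma fringe_tail_cvg0 : fringe_tail @ \oo --> 0.
Proof.
have bound0 :
    (fun k => (expR (expR 1) + 1) * expR (- (k%:R / expR 1))) @ \oo --> (0 : R).
  rewrite -[X in _ --> X](mulr0 (expR (expR 1) + 1)); apply: cvgMr.
  under eq_fun => k do rewrite -mulrN expRM_natl.
  by apply: cvg_expr; rewrite ger0_norm ?expR_ge0 // expR_lt1 oppr_lt0.
apply: squeeze_cvgr (cvg_cst (0 : R)) bound0; apply: nearW => k.
by rewrite fringe_tail_ge0 fringe_tail_upper.
Qed.

(** The layer probabilities are the differences of [fringe_tail], and no mass
escapes to infinite layers because [fringe_tail] vanishes at infinity. *)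
Lemma cum_layerE k : cum_layer R k = (fringe_tail k)%:E.
Proof.
apply: cvg_lim => //; rewrite -(cvg_shiftn k).
have sumE n : (\sum_(k <= i < n + k) (layer_lim R i)%:E)%E =
    (fringe_tail k - fringe_tail (n + k))%:E.
  rewrite sumEFin; congr EFin; rewrite -opprB -telescope_sumr ?leq_addl //.
  by rewrite -sumrN; apply: eq_bigr => i _; rewrite layer_limE opprB.
under eq_fun do rewrite sumE.
apply: cvg_EFin; first exact: nearW.
rewrite -[X in _ --> X]subr0; apply: cvgB; first exact: cvg_cst.
by rewrite (cvg_shiftn k fringe_tail); exact: fringe_tail_cvg0.
Qed.

End Limits.

Theorem theorem4 (R : realType) :
  exists C1 C2 : R, [/\ 0 < C1, 0 < C2 & forall k : nat,
    ((expR (- k%:R))%:E <= C1%:E * cum_layer R k)%E /\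
    (cum_layer R k <= (C2 * expR (- (k%:R / expR 1)))%:E)%E].
Proof.
exists 2, (expR (expR 1) + 1); split=> // k.
rewrite cum_layerE -EFinM !lee_fin; split; last exact: fringe_tail_upper.
apply: (@le_trans _ _ (2 * (2 ^- k / 2))); last first.
  by apply: ler_wpM2l => //; exact: fringe_tail_lower.
rewrite mulrC divfK // expRN lef_pV2 ?posrE ?expR_gt0 ?exprn_gt0 //.
rewrite -[k%:R]mul1r expRM_natr lerXn2r ?nnegrE ?expR_ge0 //.
by have := expR_ge1Dx (1 : R); lra.
Qed.
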